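(* Fix a subinterval $[t_k,t_{k+1}]$, an index $l$, a power $p_l\ge1$, and a point $\chi_k$. There exists a Lebesgue measurable function $t\mapsto\tilde g_k^l(t,\chi_k)$ on $[t_k,t_{k+1}]$ with $$\tilde g_k^l(t,\chi_k)\in\partial_{\chi_k}\left\{\max\bigl(0,\lambda_{max}(L_l(t,\chi_k))\bigr)^{p_l}\right\}\quad\text{for almost every } t\in[t_k,t_{k+1}],$$ and this selection is bounded on the subinterval. Hence $\tilde g_k^l(\cdot,\chi_k)$ is Lebesgue integrable on $[t_k,t_{k+1}]$.
   Context: $[t_k,t_{k+1}]$ with $t_k<t_{k+1}$ is one subinterval of a time grid. The decision vector is $\chi_k=(q_{v,k},\zeta_{v,k}^m,\zeta_{v,k+1}^p)$, a finite-dimensional real vector. Here $\zeta_v=\{y_v,z_v,\dots\}$ collects vectorized input-type variables and is interpolated by a first-order hold, $$\zeta_v(t)=\frac{t_{k+1}-t}{t_{k+1}-t_k}\,\zeta_{v,k}^m+\frac{t-t_k}{t_{k+1}-t_k}\,\zeta_{v,k+1}^p,\qquad t\in[t_k,t_{k+1}),$$ (extended continuously to $t_{k+1}$), and $q_v$ is the solution of the linear time-varying equation $\dot q_v(t)=A_q(t)q_v(t)+B_{qy}(t)y_v(t)+B_{qz}(t)z_v(t)$ on $[t_k,t_{k+1}]$ with $q_v(t_k)=q_{v,k}$, where $A_q,B_{qy},B_{qz}$ are given piecewise continuous matrix functions. Thus $q_v(t)$ and $\zeta_v(t)$ are linear in $\chi_k$ for each $t$. $L_l(t,q_v,\zeta_v)$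 is a real symmetric matrix-valued function which, for each $t$, is affine in $(q_v,\zeta_v)$, with coefficients that are bounded and piecewise continuous in $t$ (it represents a linear matrix inequality constraint $L_l\preceq0$). We write $L_l(t,\chi_k):=L_l(t,q_v(t),\zeta_v(t))$, which is affine in $\chi_k$ for each $t$. $\lambda_{max}$ denotes the largest eigenvalue and $\partial_{\chi_k}$ the convex subdifferential with respect to $\chi_k$. *)

(* Defs.v *)
From mathcomp Require Export all_boot all_order all_algebra.
From mathcomp Require Export all_classical all_reals all_analysis.
Export Order.TTheory GRing.Theory Num.Theory numFieldNormedType.Exports.

Set Implicit Arguments.
Unset Strict Implicit.
Unset Printing Implicit Defensive.

Local Open Scope classical_set_scope.
Local Open Scope ring_scope.

Section LinearAlgebra.
Context {R : realType}.

(* For a real symmetric matrix of positive size the set below is finite and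
   nonempty, so its supremum is its largest element. *)
Definition lambda_max m (A : 'M[R]_m.+1) : R :=
  sup [set x : R | eigenvalue A x].

Definition dotv n (u v : 'cV[R]_n) : R := \sum_i u i 0 * v i 0.

Definition subdifferential n (f : 'cV[R]_n -> R) (x : 'cV[R]_n) :
  set 'cV[R]_n := [set g | forall y, f x + dotv g (y - x) <= f y].

End LinearAlgebra.

(* Finitely many discontinuities in ]a, b[, and finite one-sided limits at
   every point where they make sense. *)
Definition piecewise_continuous {R : realType} {V : topologicalType}
    (a b : R) (f : R -> V) : Prop :=
  [/\ exists s : seq R,
        forall t, t \in `]a, b[ -> t \notin s -> {for t, continuous f},
      forall t, t \in `[a, b[ -> exists l : V, f x @[x --> t^'+] --> l
    & forall t, t \in `]a, b] -> exists l : V, f x @[x --> t^'-] --> l].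

Section TimeGrid.
Context {R : realType}.

(* The formula includes t = b, i.e. the continuous extension of the hold. *)
Definition foh n (a b : R) (zm zp : 'cV[R]_n) (t : R) : 'cV[R]_n :=
  ((b - t) / (b - a)) *: zm + ((t - a) / (b - a)) *: zp.

(* zeta_v = (y_v, z_v, w_v), where w_v stacks the inputs that do not enter the
   dynamics, and chi = (q_k, zeta_k^m, zeta_{k+1}^p). *)
Variables (nq ny nz nw : nat).
Notation nzeta := (ny + (nz + nw))%N.
Notation nchi := (nq + (nzeta + nzeta))%N.

Definition y_of (zeta : 'cV[R]_nzeta) : 'cV[R]_ny := usubmx zeta.
Definition z_of (zeta : 'cV[R]_nzeta) : 'cV[R]_nz := usubmx (dsubmx zeta).

Definition chi_q (chi : 'cV[R]_nchi) : 'cV[R]_nq := usubmx chi.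
Definition chi_zm (chi : 'cV[R]_nchi) : 'cV[R]_nzeta := usubmx (dsubmx chi).
Definition chi_zp (chi : 'cV[R]_nchi) : 'cV[R]_nzeta := dsubmx (dsubmx chi).

Definition zeta_v (a b : R) (chi : 'cV[R]_nchi) : R -> 'cV[R]_nzeta :=
  foh a b (chi_zm chi) (chi_zp chi).

(* The coefficients may jump at finitely many instants, so the differential
   equation is required outside a finite set, together with continuity. *)
Definition is_state (a b : R) (Aq : R -> 'M[R]_nq) (Bqy : R -> 'M[R]_(nq, ny))
    (Bqz : R -> 'M[R]_(nq, nz)) (chi : 'cV[R]_nchi) (q : R -> 'cV[R]_nq) : Prop :=
  [/\ q a = chi_q chi,
      {within `[a, b], continuous q}
    & exists s : seq R, forall t : R, t \in `]a, b[ -> t \notin s ->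
        is_derive t (1 : R) q
          (Aq t *m q t + Bqy t *m y_of (zeta_v a b chi t)
                       + Bqz t *m z_of (zeta_v a b chi t))].

Definition affine_lmi m (a b : R)
    (L : R -> 'cV[R]_nq -> 'cV[R]_nzeta -> 'M[R]_m) : Prop :=
  exists (L0 : R -> 'M[R]_m) (Lq : 'I_nq -> R -> 'M[R]_m)
         (Lz : 'I_nzeta -> R -> 'M[R]_m),
  let coefficient_ok (F : R -> 'M[R]_m) :=
    [bounded F t | t in `[a, b]] /\ piecewise_continuous a b F in
  [/\ coefficient_ok L0,
      forall i, coefficient_ok (Lq i),
      forall j, coefficient_ok (Lz j)
    & forall t q zeta, t \in `[a, b] ->
        L t q zeta = L0 t + \sum_i q i 0 *: Lq i t + \sum_j zeta j 0 *: Lz j t].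

Definition penalty m (a b p : R) (qv : 'cV[R]_nchi -> R -> 'cV[R]_nq)
    (L : R -> 'cV[R]_nq -> 'cV[R]_nzeta -> 'M[R]_m.+1)
    (t : R) (chi : 'cV[R]_nchi) : R :=
  Num.max 0 (lambda_max (L t (qv chi t) (zeta_v a b chi t))) `^ p.

End TimeGrid.

(* R with the sigma-algebra of Lebesgue (Caratheodory) measurable sets, the
   domain of completed_lebesgue_measure; R itself carries the Borel sets. *)
Notation lebesgueType R :=
  (caratheodory_type ((@wlength R idfun)^*)%mu).

(* Main.v *)
Require Import Defs.
From mathcomp Require Import measurable_realfun ring lra.

(** Write f_t for the penalty at time t, a real function of the decision
    vector.  Three facts about the family (f_t) suffice:
    - each f_t is convex ([penalty_convex]);
    - for each fixed vector y, the map t |-> f_t(y) is measurable on the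
      subinterval ([penalty_measurable]);
    - for each fixed vector y, the map t |-> f_t(y) is bounded on the
      subinterval ([penalty_bounded]).

    Measurable selection.  Rather than choosing top eigenvectors measurably, one
    computes a subgradient from values of f_t by countable limits, so that it
    inherits measurability in t ([measurable_subgradient]).  The directional derivative phi of a convex
    function at a point is sublinear, and a linear functional is a subgradient
    as soon as it lies below phi.  Replacing phi by its own directional
    derivative at a vector v gives a sublinear function below phi which is
    moreover odd along v.  Once this has been done along every vector of the
    canonical basis, the resulting sublinear function is odd along all the
    axes; its values on the basis are then the coordinates of a subgradient.
    Each directional derivative is the limit of the difference quotients of
    step 1/(n+1), so every stage stays measurable in t.

    Boundedness of the selection.  The subgradient inequality at the points
    chi + e_i and chi - e_i bounds the i-th coordinate of a subgradient by
    values of f_t at three fixed vectors ([subdifferential_entry_bound]), which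
    are bounded in t.  A bounded measurable function on a bounded interval is
    integrable.

    Convexity of f_t.  The hold is linear in the decision vector by its
    formula.  The state is linear because the defect between the state of a
    combination and the combination of the states solves the homogeneous
    equation with zero initial value and therefore vanishes, by a Gronwall
    argument ([linear_ode_zero], [state_linear]).  So the matrix inequality is
    affine in the decision vector.  The largest eigenvalue of a symmetric
    matrix is the maximum of the quadratic form over the unit sphere
    ([lambda_max_qform]), hence convex, and u |-> max(0, u)^p is convex and
    nondecreasing.

    Regularity in t.  The same variational formula shows that the largest
    eigenvalue is bounded by, and Lipschitz for, the sum of the absolute values
    of the entries.  The entries of the matrix inequality are bounded on the
    subinterval and continuous in t off a finite set, and so is the largest
    eigenvalue. *)

Set Implicit Arguments.
Unset Strict Implicit.
Unset Printing Implicit Defensive.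

Local Open Scope classical_set_scope.
Local Open Scope ring_scope.

(** * Directional derivatives of convex functions *)

Section DirectionalDerivative.
Context {R : realType} {V : lmodType R}.
Implicit Types (f phi : V -> R) (x d e : V).

Definition convexf f := forall s x y, 0 <= s <= 1 ->
  f (s *: x + (1 - s) *: y) <= s * f x + (1 - s) * f y.

Definition sublinear phi :=
  (forall d e, phi (d + e) <= phi d + phi e) /\
  (forall s d, 0 <= s -> phi (s *: d) = s * phi d).

Lemma sublinear_convexf phi : sublinear phi -> convexf phi.
Proof.
move=> [sub hom] s x y /andP[s0 s1]; apply: le_trans (sub _ _) _.
by rewrite !hom ?subr_ge0.
Qed.

Definition diff_quot f x d (s : R) := (f (x + s *: d) - f x) / s.

(** For convex f the infimum of the quotients is also their limit as the step
    tends to 0; the infimum makes upper bounds and homogeneity immediate. *)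
Definition dir_deriv f x d := inf [set diff_quot f x d s | s in [set s | 0 < s]].

Lemma diff_quot_nondecreasing f x d s r : convexf f -> 0 < s -> s <= r ->
  diff_quot f x d s <= diff_quot f x d r.
Proof.
move=> cf s0 sr; have r0 : 0 < r by exact: lt_le_trans sr.
have := cf (s / r) (x + r *: d) x.
rewrite divr_ge0 ?(ltW s0) ?(ltW r0)//= ler_pdivrMr// mul1r => /(_ sr).
have -> : (s / r) *: (x + r *: d) + (1 - s / r) *: x = x + s *: d.
  rewrite scalerDr scalerA divfK ?gt_eqF// addrAC -scalerDl.
  by rewrite addrC addrCA addrN addr0 scale1r addrC.
move=> h; rewrite /diff_quot ler_pdivrMr//.
have -> : (f (x + r *: d) - f x) / r * s = s / r * (f (x + r *: d) - f x) by ring.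
by nra.
Qed.

(** The point x lies on the segment from x - d to x + s d, so the slope on the
    right is at least the slope on the left. *)
Lemma diff_quot_ge f x d s : convexf f -> 0 < s ->
  f x - f (x - d) <= diff_quot f x d s.
Proof.
move=> cf s0; have s1 : 0 < 1 + s by rewrite addr_gt0.
have := cf (1 + s)^-1 (x + s *: d) (x - d).
rewrite invr_ge0 (ltW s1)/= invf_le1// lerDl (ltW s0) => /(_ isT).
have E : 1 - (1 + s)^-1 = (1 + s)^-1 * s by field; rewrite gt_eqF.
rewrite E -scalerA -scalerDr scalerBr addrACA addrN addr0.
rewrite -{1}[x in x + s *: x]scale1r -scalerDl scalerA mulVf ?gt_eqF// scale1r.
rewrite -mulrA -mulrDr ler_pdivlMl// => h.
by rewrite /diff_quot ler_pdivlMr//; nra.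
Qed.

Lemma diff_quot_has_inf f x d : convexf f ->
  has_inf [set diff_quot f x d s | s in [set s | 0 < s]].
Proof.
move=> cf; split; first by exists (diff_quot f x d 1), 1 => //=.
by exists (f x - f (x - d)) => _ [s /= s0 <-]; exact: diff_quot_ge.
Qed.

Lemma dir_deriv_le f x d s : convexf f -> 0 < s ->
  dir_deriv f x d <= diff_quot f x d s.
Proof.
by move=> cf s0; apply: ge_inf; [exact: (diff_quot_has_inf x d cf).2|exists s].
Qed.

Lemma le_dir_deriv f x d c : (forall s, 0 < s -> c <= diff_quot f x d s) ->
  c <= dir_deriv f x d.
Proof.
move=> h; apply: lb_le_inf; first by exists (diff_quot f x d 1), 1 => //=.
by move=> _ [s /= s0 <-]; exact: h.
Qed.

Lemma dir_deriv_le1 f x d : convexf f -> dir_deriv f x d <= f (x + d) - f x.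
Proof.
by move=> cf; have := dir_deriv_le x d cf ltr01; rewrite /diff_quot scale1r divr1.
Qed.

Lemma dir_deriv_ge1 f x d : convexf f -> f x - f (x - d) <= dir_deriv f x d.
Proof. by move=> cf; apply: le_dir_deriv => s; exact: diff_quot_ge. Qed.

(** Subadditivity: x + (u/2)(d + e) is the midpoint of x + u d and x + u e, where
    u is a step good for both directions by monotonicity of the quotients. *)
Lemma dir_deriv_sublinear f x : convexf f -> sublinear (dir_deriv f x).
Proof.
move=> cf; split=> [d e|s d].
  rewrite -lerBlDr; apply: le_dir_deriv => s s0.
  rewrite lerBlDr -lerBlDl; apply: le_dir_deriv => r r0; rewrite lerBlDl.
  pose u := Num.min s r.
  have u0 : 0 < u by rewrite lt_min s0.
  have u2 : 0 < u / 2 by rewrite divr_gt0.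
  have us : diff_quot f x d u <= diff_quot f x d s.
    by apply: diff_quot_nondecreasing => //; rewrite ge_min lexx.
  have ur : diff_quot f x e u <= diff_quot f x e r.
    by apply: diff_quot_nondecreasing => //; rewrite ge_min lexx orbT.
  apply: le_trans (dir_deriv_le x (d + e) cf u2) _.
  apply: le_trans _ (lerD us ur); rewrite /diff_quot -mulrDl.
  have := cf 2^-1 (x + u *: d) (x + u *: e).
  have E : 1 - 2^-1 = 2^-1 :> R by field.
  rewrite E -scalerDr.
  have -> : 2^-1 *: (x + u *: d + (x + u *: e)) = x + (u / 2) *: (d + e).
    rewrite addrACA -[u *: d + _]scalerDr -mulr2n -[x *+ 2]scaler_nat.
    by rewrite [LHS]scalerDr !scalerA mulVf ?pnatr_eq0// scale1r [_ * u]mulrC.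
  move=> h; rewrite invfM invrK mulrCA [leRHS]mulrC ler_pM2l ?invr_gt0//.
  by have := h ltac:(lra); lra.
rewrite le_eqVlt => /orP[/eqP <-|s0].
  rewrite scale0r mul0r; apply/eqP; rewrite eq_le; apply/andP; split.
    by apply: le_trans (dir_deriv_le1 _ _ cf) _; rewrite addr0 subrr.
  by apply: le_trans (dir_deriv_ge1 _ _ cf); rewrite subr0 subrr.
apply/eqP; rewrite eq_le; apply/andP; split.
  rewrite -ler_pdivrMl//; apply: le_dir_deriv => r r0; rewrite ler_pdivrMl//.
  apply: le_trans (dir_deriv_le _ _ cf (divr_gt0 r0 s0)) _.
  rewrite /diff_quot scalerA divfK ?gt_eqF// le_eqVlt; apply/orP; left; apply/eqP.
  by field; rewrite !gt_eqF.
apply: le_dir_deriv => r r0; rewrite -ler_pdivlMl//.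
apply: le_trans (dir_deriv_le _ _ cf (mulr_gt0 r0 s0)) _.
rewrite /diff_quot scalerA le_eqVlt; apply/orP; left; apply/eqP.
by field; rewrite !gt_eqF.
Qed.

(** It expresses the infimum over the uncountable set of steps as a limit of a
    sequence, as needed for measurability. *)
Lemma cvg_diff_quot f x d : convexf f ->
  diff_quot f x d n.+1%:R^-1 @[n --> \oo] --> dir_deriv f x d.
Proof.
move=> cf; apply/cvgrPdist_le => e e0.
have [_ [s /= s0 <-] hs] := inf_adherent e0 (diff_quot_has_inf x d cf).
near=> n; have /ltW ns : n.+1%:R^-1 < s.
  by near: n; exact: near_infty_natSinv_lt (PosNum s0).
have n0 : 0 < n.+1%:R^-1 :> R by rewrite invr_gt0.
have h1 := dir_deriv_le x d cf n0.
rewrite distrC ger0_norm ?subr_ge0// lerBlDl.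
apply: le_trans (ltW hs); exact: diff_quot_nondecreasing.
Unshelve. all: by end_near. Qed.

End DirectionalDerivative.

(** * Iterated directional derivatives and measurable subgradients *)

Section LexicographicDerivative.
Context {R : realType} {V : lmodType R}.
Implicit Types (phi : V -> R) (vs : seq V).

(** The derivative of phi at the first vector, then the derivative of the result
    at the second one, and so on. *)
Definition lex_deriv phi vs := foldl (fun psi v => dir_deriv psi v) phi vs.

(** Subadditivity bounds phi(v + d) - phi(v), the quotient of step 1. *)
Lemma dir_deriv_le_fun phi v d : sublinear phi -> dir_deriv phi v d <= phi d.
Proof.
move=> sl; apply: le_trans (dir_deriv_le1 _ _ (sublinear_convexf sl)) _.
by rewrite lerBlDl; exact: sl.1.
Qed.

Lemma lex_deriv_sublinear phi vs : sublinear phi -> sublinear (lex_deriv phi vs).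
Proof.
elim: vs phi => [//|v vs IH] phi sl; apply: IH.
exact/dir_deriv_sublinear/sublinear_convexf.
Qed.

Lemma lex_deriv_le phi vs d : sublinear phi -> lex_deriv phi vs d <= phi d.
Proof.
elim: vs phi => [//|v vs IH] phi sl; apply: le_trans (dir_deriv_le_fun v d sl).
exact/IH/dir_deriv_sublinear/sublinear_convexf.
Qed.

(** Differentiating at v makes phi odd along v: the step 1 in direction -v gives
    a value at most phi(0) - phi(v).  Later stages only decrease the function,
    and a sublinear function below one that is odd along v is odd along v. *)
Lemma lex_derivN phi vs v : sublinear phi -> v \in vs ->
  lex_deriv phi vs (- v) <= - lex_deriv phi vs v.
Proof.
elim: vs phi => [//|w vs IH] phi sl; have cf := sublinear_convexf sl.
have sl' := dir_deriv_sublinear w cf.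
rewrite inE => /orP[/eqP ->|]; last exact: IH.
apply: le_trans (lex_deriv_le vs (- w) sl') _.
have phi0 : phi 0 = 0 by rewrite -(scale0r 0) sl.2// mul0r.
apply: le_trans (dir_deriv_le1 _ _ cf) _; rewrite subrr phi0 sub0r lerN2.
by apply: le_trans (lex_deriv_le vs w sl') _; exact: dir_deriv_le_fun.
Qed.

End LexicographicDerivative.

Section MeasurableSelection.
Context {R : realType}.

(** Oddness along the axes turns positive homogeneity into homogeneity there, so
    subadditivity gives phi(c) <= g.c for every c; the case c = -d together with
    0 <= phi(d) + phi(-d) gives the reverse inequality at d. *)
Lemma sublinear_ge_dotv n (phi : 'cV[R]_n -> R) (d : 'cV[R]_n) : sublinear phi ->
  (forall i, phi (- delta_mx i 0) <= - phi (delta_mx i 0)) ->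
  dotv (\col_i phi (delta_mx i 0)) d <= phi d.
Proof.
move=> sl odd; have [sub hom] := sl.
have phi0 : phi 0 = 0 by rewrite -(scale0r 0) hom// mul0r.
have hle s i : phi (s *: delta_mx i 0) <= s * phi (delta_mx i 0).
  have [s0|/ltW s0] := leP 0 s; first by rewrite hom.
  rewrite -[s]opprK scaleNr -scalerN hom ?oppr_ge0// [leRHS]mulNr -mulrN.
  by rewrite ler_wpM2l ?oppr_ge0.
have upper c : phi c <= dotv (\col_i phi (delta_mx i 0)) c.
  have {1}-> : c = \sum_i c i 0 *: delta_mx i 0.
    apply/colP => i; rewrite summxE (bigD1 i)//= big1 => [|j ji].
      by rewrite !mxE !eqxx mulr1 addr0.
    by rewrite !mxE eq_sym (negbTE ji) mulr0.
  rewrite /dotv; elim/big_rec2: _ => [|i u v _ h]; first by rewrite phi0.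
  apply: le_trans (sub _ _) _; apply: lerD => //.
  by rewrite mxE mulrC.
have dotN : dotv (\col_i phi (delta_mx i 0)) (- d)
          = - dotv (\col_i phi (delta_mx i 0)) d.
  by rewrite /dotv -sumrN; apply: eq_bigr => i _; rewrite [(- d) i 0]mxE mulrN.
have := upper (- d); rewrite dotN => h.
by have := sub d (- d); rewrite subrr phi0 => h'; lra.
Qed.

Context {disp : measure_display} {T : measurableType disp}.

Lemma measurable_dir_deriv (V : lmodType R) (D : set T) (f : T -> V -> R) x :
  measurable D -> (forall t, D t -> convexf (f t)) ->
  (forall y, measurable_fun D (f ^~ y)) ->
  forall d, measurable_fun D (fun t => dir_deriv (f t) x d).
Proof.
move=> mD cf mf d.
apply: (measurable_fun_cvg (h := fun n t => diff_quot (f t) x d n.+1%:R^-1)).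
  move=> n; apply: measurable_funM => //; exact: measurable_funB.
by move=> t Dt; exact/cvg_diff_quot/cf.
Qed.

Lemma measurable_lex_deriv (V : lmodType R) (D : set T) (phi : T -> V -> R) vs :
  measurable D -> (forall t, D t -> sublinear (phi t)) ->
  (forall y, measurable_fun D (phi ^~ y)) ->
  forall d, measurable_fun D (fun t => lex_deriv (phi t) vs d).
Proof.
move=> mD; elim: vs phi => [//|v vs IH] phi sl mphi.
apply: (IH (fun t => dir_deriv (phi t) v)).
  by move=> t Dt; exact/dir_deriv_sublinear/sublinear_convexf/sl.
by apply: measurable_dir_deriv => // t Dt; exact/sublinear_convexf/sl.
Qed.

Lemma measurable_subgradient n (D : set T) (f : T -> 'cV[R]_n -> R) x :
  measurable D -> (forall t, D t -> convexf (f t)) ->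
  (forall y, measurable_fun D (f ^~ y)) ->
  exists g : T -> 'cV[R]_n, (forall i, measurable_fun D (fun t => g t i 0)) /\
    forall t, D t -> subdifferential (f t) x (g t).
Proof.
move=> mD cf mf.
pose vs := [seq delta_mx i 0 : 'cV[R]_n | i <- enum 'I_n].
pose phi t := lex_deriv (dir_deriv (f t) x) vs.
exists (fun t => \col_i phi t (delta_mx i 0)); split=> [i|t Dt y].
  under eq_fun do rewrite mxE.
  apply: measurable_lex_deriv => //; first by move=> t Dt; exact/dir_deriv_sublinear/cf.
  exact: measurable_dir_deriv.
have sl := dir_deriv_sublinear x (cf t Dt).
have slphi := lex_deriv_sublinear vs sl.
have h : dotv (\col_i phi t (delta_mx i 0)) (y - x) <= phi t (y - x).
  apply: sublinear_ge_dotv => // i; apply: lex_derivN => //.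
  by apply: map_f; rewrite mem_enum.
have := lex_deriv_le vs (y - x) sl; have := dir_deriv_le1 x (y - x) (cf t Dt).
rewrite [x + _]addrC subrK; move: h; rewrite -/(phi t _); lra.
Qed.

End MeasurableSelection.

(** * The largest eigenvalue of a symmetric matrix *)

Section SymmetricMatrices.
Context {R : realType}.

Definition sqn n (v : 'rV[R]_n) : R := (v *m v^T) 0 0.

Definition qform n (A : 'M[R]_n) (v : 'rV[R]_n) : R := (v *m A *m v^T) 0 0.

Lemma sqnE n (v : 'rV[R]_n) : sqn v = \sum_i v 0 i ^+ 2.
Proof. by rewrite /sqn mxE; apply: eq_bigr => i _; rewrite mxE expr2. Qed.

Lemma qformE n (A : 'M[R]_n) v : qform A v = \sum_j (\sum_i v 0 i * A i j) * v 0 j.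
Proof. by rewrite /qform mxE; apply: eq_bigr => j _; rewrite !mxE. Qed.

Lemma sqn_ge0 n (v : 'rV[R]_n) : 0 <= sqn v.
Proof. by rewrite sqnE sumr_ge0// => i _; rewrite sqr_ge0. Qed.

Lemma sqr_coord_le_sqn n (v : 'rV[R]_n) i : v 0 i ^+ 2 <= sqn v.
Proof.
by rewrite sqnE (bigD1 i)//= lerDl sumr_ge0// => j _; rewrite sqr_ge0.
Qed.

Lemma sqn_eq0 n (v : 'rV[R]_n) : (sqn v == 0) = (v == 0).
Proof.
apply/eqP/eqP => [v0|->]; last by rewrite /sqn mul0mx mxE.
apply/rowP => i; rewrite mxE; apply/eqP; rewrite -sqrf_eq0 eq_le sqr_ge0 andbT.
by rewrite -v0; exact: sqr_coord_le_sqn.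
Qed.

Lemma sqn_gt0 n (v : 'rV[R]_n) : (0 < sqn v) = (v != 0).
Proof. by rewrite lt_def sqn_ge0 andbT sqn_eq0. Qed.

Lemma sqnZ n s (v : 'rV[R]_n) : sqn (s *: v) = s ^+ 2 * sqn v.
Proof. by rewrite !sqnE mulr_sumr; apply: eq_bigr => i _; rewrite mxE exprMn. Qed.

Lemma qformZ n (A : 'M[R]_n) s v : qform A (s *: v) = s ^+ 2 * qform A v.
Proof.
by rewrite /qform -scalemxAl linearZ/= -scalemxAl -scalemxAr scalerA mxE expr2.
Qed.

Lemma qform_comb n s r (A B : 'M[R]_n) v :
  qform (s *: A + r *: B) v = s * qform A v + r * qform B v.
Proof. by rewrite /qform mulmxDr mulmxDl -!scalemxAr -!scalemxAl !mxE. Qed.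

Lemma qform_le n (A : 'M[R]_n) v :
  `|qform A v| <= (\sum_j \sum_i `|A i j|) * sqn v.
Proof.
rewrite qformE mulr_suml; apply: le_trans (ler_norm_sum _ _ _) _.
apply: ler_sum => j _; rewrite !mulr_suml.
apply: le_trans (ler_norm_sum _ _ _) _; apply: ler_sum => i _.
rewrite mulrAC mulrC normrM ler_wpM2l// normrM.
have := sqr_coord_le_sqn v i; have := sqr_coord_le_sqn v j.
rewrite -(real_normK (num_real (v 0 i))) -(real_normK (num_real (v 0 j))).
have := sqr_ge0 (`|v 0 i| - `|v 0 j|); nra.
Qed.

Lemma cvg_sum {I : Type} {T : Type} (F : set_system T) {FF : Filter F} (r : seq I)
    (f : I -> T -> R) (l : I -> R) :
  (forall i, f i x @[x --> F] --> l i) ->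
  \sum_(i <- r) f i x @[x --> F] --> \sum_(i <- r) l i.
Proof. by move=> h; apply: cvg_big => //; exact: add_continuous. Qed.

Lemma sqn_continuous n : continuous (@sqn n).
Proof.
rewrite (funext (@sqnE n)) => v.
apply: (cvg_sum (F := nbhs v)) => i; under eq_cvg do rewrite expr2.
by rewrite expr2; apply: cvgM; exact: coord_continuous.
Qed.

Lemma qform_continuous n (A : 'M[R]_n) : continuous (qform A).
Proof.
rewrite (funext (qformE A)) => v.
apply: (cvg_sum (F := nbhs v)) => j; apply: cvgM; last exact: coord_continuous.
by apply: (cvg_sum (F := nbhs v)) => i; apply: cvgM; [exact: coord_continuous|exact: cvg_cst].
Qed.

(** The quadratic form attains its maximum on the compact unit sphere; the bound
    elsewhere follows by homogeneity. *)
Lemma qform_max n (A : 'M[R]_n.+1) : exists2 w, sqn w = 1 &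
  forall v, qform A v <= qform A w * sqn v.
Proof.
have S0 : [set v : 'rV[R]_n.+1 | sqn v = 1] !=set0.
  exists (delta_mx 0 0); rewrite /= sqnE (bigD1 0)//= big1 => [|i /negbTE i0].
    by rewrite mxE !eqxx expr1n addr0.
  by rewrite mxE i0 andbF expr0n.
have cS : compact [set v : 'rV[R]_n.+1 | sqn v = 1].
  apply: bounded_closed_compact.
    exists 1; split => // M M1 v /= v1; apply: le_trans (ltW M1).
    rewrite [leLHS]/Num.Def.normr/= mx_normrE; apply: bigmax_le => // -[i j] _ /=.
    rewrite (ord1 i) -[leRHS]normr1 -ler_sqr ?nnegrE// !real_normK ?num_real//.
    by rewrite expr1n -v1; exact: sqr_coord_le_sqn.
  apply: (@preimage_closed _ _ (@sqn n.+1) [set x | x = 1]).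
    by move=> v _; exact: sqn_continuous.
  exact: closed_eq.
have [w] := EVT_max_rV S0 cS (continuous_subspaceT (@qform_continuous _ A)).
rewrite inE /= => w1 wmax; exists w => // v.
have [->|v0] := eqVneq v 0.
  by rewrite -(scale0r 0) qformZ sqnZ expr0n/= !mul0r mulr0.
have vp : 0 < sqn v by rewrite sqn_gt0.
have := wmax ((Num.sqrt (sqn v))^-1 *: v).
rewrite inE/= sqnZ qformZ exprVn sqr_sqrtr ?sqn_ge0// mulVf ?gt_eqF// => /(_ erefl).
by rewrite ler_pdivrMl// mulrC.
Qed.

(** With B = lam - A positive semidefinite and w isotropic for B, the form B
    evaluated on the line w + s u, where u = w B, is a quadratic polynomial in s
    without constant term; being nonnegative it has no linear term, and that
    term is 2 s |u|^2. *)
Lemma qform_max_eigenvector n (A : 'M[R]_n) lam w : A^T = A ->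
  (forall v, qform A v <= lam * sqn v) -> qform A w = lam * sqn w ->
  w *m A = lam *: w.
Proof.
move=> symA ub weq; pose B := lam%:M - A.
have BE v : qform B v = lam * sqn v - qform A v.
  by rewrite /qform /sqn mulmxBr mulmxBl mul_mx_scalar -scalemxAl !mxE.
have B0 v : 0 <= qform B v by rewrite BE subr_ge0.
have Bw : qform B w = 0 by rewrite BE weq subrr.
suff : w *m B = 0.
  by rewrite mulmxBr mul_mx_scalar => /eqP; rewrite subr_eq0 => /eqP.
have symB : B^T = B by rewrite linearB/= symA tr_scalar_mx.
clearbody B; pose u := w *m B; apply/eqP; rewrite -sqn_eq0 -/u; apply/eqP.
have expand s : qform B (w + s *: u) = 2 * s * sqn u + s ^+ 2 * qform B u.
  have sym : (u *m B *m w^T) 0 0 = sqn u.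
    by rewrite -mulmxA -{1}symB -trmx_mul.
  have uT : (w + s *: u)^T = w^T + s *: u^T by rewrite linearD linearZ/=.
  rewrite /qform uT !mulmxDl !mulmxDr -!scalemxAl -!scalemxAr.
  have entD (X Y : 'M[R]_1) : (X + Y) 0 0 = X 0 0 + Y 0 0 by rewrite mxE.
  have entZ (X : 'M[R]_1) : (s *: X) 0 0 = s * X 0 0 by rewrite mxE.
  rewrite !(entD, entZ) -/(qform B w) -/(qform B u) Bw sym -/u -/(sqn u); ring.
have := B0 u; set e := qform B u => e0.
have e1 : 0 < e + 1 by rewrite ltr_wpDl.
(* The minimiser -|u|^2/e is replaced by a step that also makes sense for e = 0. *)
have := B0 (w + (- (sqn u / (e + 1))) *: u); rewrite expand -/e.
have -> : 2 * - (sqn u / (e + 1)) * sqn u + (- (sqn u / (e + 1))) ^+ 2 * e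
        = - ((sqn u / (e + 1)) ^+ 2 * (e + 2)) by field; rewrite gt_eqF.
rewrite oppr_ge0 pmulr_lle0 ?ltr_wpDl// => h.
have /eqP : (sqn u / (e + 1)) ^+ 2 = 0 by apply/eqP; rewrite eq_le h sqr_ge0.
by rewrite sqrf_eq0 mulf_eq0 invr_eq0 (gt_eqF e1) orbF => /eqP.
Qed.

(** The Rayleigh characterisation: it reduces every property of the supremum of
    the spectrum to a property of quadratic forms. *)
Lemma lambda_max_qform n (A : 'M[R]_n.+1) : A^T = A ->
  (exists2 w, sqn w = 1 & qform A w = lambda_max A) /\
  forall v, qform A v <= lambda_max A * sqn v.
Proof.
move=> symA; have [w w1 wmax] := qform_max A.
suff -> : lambda_max A = qform A w by split => //; exists w.
have ev : eigenvalue A (qform A w).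
  apply/eigenvalueP; exists w; last by rewrite -sqn_gt0 w1.
  by apply: qform_max_eigenvector => //; rewrite w1 mulr1.
have ub : ubound [set x | eigenvalue A x] (qform A w).
  move=> x /= /eigenvalueP[v vA v0]; have := wmax v.
  rewrite {1}/qform vA -scalemxAl mxE -/(sqn v) ler_pM2r//.
  by rewrite sqn_gt0.
apply/eqP; rewrite eq_le; apply/andP; split.
  by apply: ge_sup ub; exists (qform A w).
by apply: ub_le_sup => //; exists (qform A w).
Qed.

Lemma lambda_max_convex n (A B : 'M[R]_n.+1) s : 0 <= s <= 1 ->
  A^T = A -> B^T = B ->
  lambda_max (s *: A + (1 - s) *: B) <= s * lambda_max A + (1 - s) * lambda_max B.
Proof.
move=> /andP[s0 s1] symA symB.
have [[w w1 <-] _] : _ := @lambda_max_qform n (s *: A + (1 - s) *: B) ltac:(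
  by rewrite linearD/= !linearZ/= symA symB).
rewrite qform_comb; apply: lerD; apply: ler_wpM2l; rewrite ?subr_ge0//.
  by have := (lambda_max_qform symA).2 w; rewrite w1 mulr1.
by have := (lambda_max_qform symB).2 w; rewrite w1 mulr1.
Qed.

(** A unit vector maximising the form of one matrix is a competitor for the
    other. *)
Lemma lambda_max_lipschitz n (A B : 'M[R]_n.+1) : A^T = A -> B^T = B ->
  `|lambda_max A - lambda_max B| <= \sum_j \sum_i `|A i j - B i j|.
Proof.
have half (C D : 'M[R]_n.+1) : C^T = C -> D^T = D ->
    lambda_max C - lambda_max D <= \sum_j \sum_i `|C i j - D i j|.
  move=> symC symD; have [[w w1 <-] _] := lambda_max_qform symC.
  have := (lambda_max_qform symD).2 w; rewrite w1 mulr1 => h.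
  have := qform_le (C - D) w; rewrite w1 mulr1.
  under eq_bigr do under eq_bigr do rewrite !mxE.
  have -> : C - D = 1 *: C + (-1) *: D by rewrite scale1r scaleN1r.
  by rewrite qform_comb => /(le_trans (ler_norm _)); lra.
move=> symA symB; rewrite ler_norml half// andbT lerNl opprB.
apply: le_trans (half _ _ symB symA) _; apply: ler_sum => j _.
by apply: ler_sum => i _; rewrite distrC.
Qed.

End SymmetricMatrices.

(** * Functions on an interval with finitely many exceptional points *)

Section RealLine.
Context {R : realType}.

Lemma measurable_continuous_off_finite (a b : R) (s : seq R) (f : R -> R) :
  (forall t, t \in `]a, b[ -> t \notin s -> {for t, continuous f}) ->
  measurable_fun `[a, b] f.
Proof.
move=> cf.
pose S := [set` s] `|` [set a] `|` [set b].
pose D := `]a, b[ `&` ~` [set` s].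
have finS : finite_set S.
  by rewrite /S !finite_setU; split; [split|]; [exact: finite_seq|exact: finite_set1..].
have mcount (A : set R) : A `<=` S -> measurable A.
  move=> AS; apply: countable_measurable; first by move=> ?; exact: measurable_set1.
  exact/finite_set_countable/(sub_finite_set AS).
have oD : open D.
  apply: openI; first exact: interval_open.
  apply: closed_openC; apply: (compact_closed (@Rhausdorff R)).
  exact/finite_compact/finite_seq.
have mD : measurable D by exact: open_measurable.
apply: (@measurable_funS _ _ _ _ (D `|` S)).
- by apply: measurableU => //; exact: mcount.
- move=> t /=; rewrite in_itv/= !le_eqVlt => /andP[/orP[/eqP <-|at_]].
    by move=> _; right; left; right.
  move=> /orP[/eqP ->|tb]; first by right; right.
  have [ts|/negP ts] := boolP (t \in s); first by right; left; left.
  by left; split => //=; rewrite in_itv/= at_.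
- apply/measurable_funU => //; first exact: mcount; split.
    apply: open_continuous_measurable_fun => // t.
    by rewrite inE => -[/= tab /negP ts]; exact: cf.
  by move=> _ Y mY; apply: mcount => t [].
Qed.

(** An exceptional point inside the interval is removed by cutting the interval
    there, continuity taking care of the common endpoint. *)
Lemma nonincreasing_off_finite (s : seq R) (f : R -> R) (a b : R) : a <= b ->
  {within `[a, b], continuous f} ->
  (forall t, t \in `]a, b[ -> t \notin s -> derivable f t 1 /\ 'D_1 f t <= 0) ->
  f b <= f a.
Proof.
elim: s a b => [|c s IH] a b ab cf df.
  apply: (ler0_derive1_le_cc _ _ cf); rewrite ?in_itv/= ?lexx ?ab//.
    by move=> t tab; exact: (df t tab isT).1.
  by move=> t tab; rewrite derive1E; exact: (df t tab isT).2.
have [cab|cab] := boolP (c \in `]a, b[); last first.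
  apply: IH => // t tab ts; apply: df => //.
  rewrite inE negb_or ts andbT; apply: contraNneq cab => <-//.
move: cab; rewrite in_itv/= => /andP[ac cb].
have h u v : `[u, v] `<=` `[a, b] -> `]u, v[ `<=` `]a, b[ -> c \notin `]u, v[ ->
    u <= v -> f v <= f u.
  move=> sub subo cuv uv; apply: IH => //; first exact: continuous_subspaceW cf.
  move=> t tuv ts; apply: df; first exact: subo.
  by rewrite inE negb_or ts andbT; apply: contraNneq cuv => <-.
apply: (@le_trans _ _ (f c)).
  apply: h; rewrite ?ltW//.
  - by apply: subset_itvr; rewrite bnd_simp ltW.
  - by apply: subset_itvr; rewrite bnd_simp ltW.
  - by rewrite in_itv/= ltxx.
apply: h; rewrite ?ltW//.
- by apply: subset_itvl; rewrite bnd_simp ltW.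
- by apply: subset_itvl; rewrite bnd_simp ltW.
- by rewrite in_itv/= ltxx andbF.
Qed.

End RealLine.

Section BoundedFunctions.
Context {R : realType} {T : Type}.
Implicit Types (D : set T).

(** Boundedness with one explicit constant, closed under the operations used
    below. *)
Definition bounded_over {V : normedModType R} D (f : T -> V) :=
  exists K : R, forall t, D t -> `|f t| <= K.

Lemma bounded_overP {V : normedModType R} D (f : T -> V) :
  [bounded f t | t in D] <-> bounded_over D f.
Proof.
split=> [[M [_ /(_ (M + 1))]]|[K h]].
  by rewrite ltrDl => /(_ ltr01) h; exists (M + 1).
by exists K; split=> [|M KM t Dt]; [exact: num_real|exact: le_trans (h t Dt) (ltW KM)].
Qed.

Lemma bounded_over_mx m n D (f : T -> 'M[R]_(m, n)) :
  bounded_over D f <-> forall i j, bounded_over D (fun t => f t i j).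
Proof.
split=> [[K h] i j|h].
  exists K => t Dt; apply: le_trans (h t Dt).
  by rewrite [leRHS]/Num.Def.normr/= mx_normrE; exact: (le_bigmax _ _ (i, j)).
pose K (ij : 'I_m * 'I_n) := sval (cid (h ij.1 ij.2)).
exists (\big[Num.max/0]_ij K ij) => t Dt.
rewrite [leLHS]/Num.Def.normr/= mx_normrE; apply: bigmax_le.
  by apply/bigmax_geP; left.
move=> ij _; apply: le_trans (le_bigmax _ _ ij).
by rewrite /K; case: cid => k /= /(_ t Dt).
Qed.

Lemma bounded_overD D (f g : T -> R) : bounded_over D f -> bounded_over D g ->
  bounded_over D (fun t => f t + g t).
Proof.
move=> [K hK] [M hM]; exists (K + M) => t Dt.
by apply: le_trans (ler_normD _ _) _; apply: lerD; [exact: hK|exact: hM].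
Qed.

Lemma bounded_overM D (f g : T -> R) : bounded_over D f -> bounded_over D g ->
  bounded_over D (fun t => f t * g t).
Proof.
move=> [K hK] [M hM]; exists (K * M) => t Dt.
by rewrite normrM; apply: ler_pM => //; [exact: hK|exact: hM].
Qed.

Lemma bounded_over_norm D (f : T -> R) : bounded_over D f ->
  bounded_over D (fun t => `|f t|).
Proof. by move=> [K hK]; exists K => t Dt; rewrite normr_id; exact: hK. Qed.

Lemma bounded_over_sum D {I : Type} (r : seq I) (f : I -> T -> R) :
  (forall i, bounded_over D (f i)) -> bounded_over D (fun t => \sum_(i <- r) f i t).
Proof.
move=> h; elim: r => [|i r IH].
  by exists 0 => t _; rewrite big_nil normr0.
by under eq_fun do rewrite big_cons; exact: bounded_overD.
Qed.

End BoundedFunctions.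

Lemma continuous_itv_bounded {R : realType} {V : normedModType R} (a b : R) (f : R -> V) :
  {within `[a, b], continuous f} -> bounded_over `[a, b] f.
Proof.
move=> /continuous_compact /(_ (segment_compact (a := a) (b := b))).
move=> /compact_bounded[K [_ /(_ (K + 1))]] h; exists (K + 1) => t tab.
by apply: h; [rewrite ltrDl|exists t].
Qed.

(** One-sided limits make f bounded on one-sided neighbourhoods of each point, and
    a single constant is obtained by compactness. *)
Lemma piecewise_continuous_bounded {R : realType} {V : normedModType R} (a b : R)
  (f : R -> V) : piecewise_continuous a b f -> bounded_over `[a, b] f.
Proof.
move=> [_ fr fl].
have right t : t \in `[a, b] ->
    exists K, \forall t' \near t, t' \in `[a, b] -> t < t' -> `|f t'| <= K.
  rewrite in_itv/= => /andP[at_]; rewrite le_eqVlt => /orP[/eqP ->|tb].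
    exists 0; near=> t'; rewrite in_itv/= => /andP[_ t'b] bt'.
    by have := lt_le_trans bt' t'b; rewrite ltxx.
  have [|l fl'] := fr t; first by rewrite in_itv/= at_.
  exists (`|l| + 1); have : `|l| < `|l| + 1 by rewrite ltrDl.
  move=> /(cvgr_norm_le _ fl'); rewrite near_withinE.
  by apply: filterS => t' h _ /h.
have left t : t \in `[a, b] ->
    exists K, \forall t' \near t, t' \in `[a, b] -> t' < t -> `|f t'| <= K.
  rewrite in_itv/= => /andP[+ tb]; rewrite le_eqVlt => /orP[/eqP <-|at_].
    exists 0; near=> t'; rewrite in_itv/= => /andP[at' _] ta.
    by have := lt_le_trans ta at'; rewrite ltxx.
  have [|l fl'] := fl t; first by rewrite in_itv/= at_.
  exists (`|l| + 1); have : `|l| < `|l| + 1 by rewrite ltrDl.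
  move=> /(cvgr_norm_le _ fl'); rewrite near_withinE.
  by apply: filterS => t' h _ /h.
have := @segment_compact _ a b.
move=> /compact_near_coveringP/near_covering_withinP.
move=> /(_ R +oo (fun M t => `|f t| <= M)) [|M [_ /(_ (M + 1))]].
  move=> t tab; have [K rK] := right t tab; have [K' lK] := left t tab.
  have KM : \forall M \near +oo, [/\ K <= M, K' <= M & `|f t| <= M].
    near=> M; split; near: M; apply: nbhs_pinfty_ge; exact: num_real.
  near=> t' M => t'ab.
  have [KM1 KM2 KM3] : [/\ K <= M, K' <= M & `|f t| <= M] by exact: (near KM M).
  have [tt'|t't|<-//] := ltgtP t t'.
    apply: le_trans KM1; exact: (near rK t').
  apply: le_trans KM2; exact: (near lK t').
by rewrite ltrDl => /(_ ltr01) h; exists (M + 1).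
Unshelve. all: by end_near. Qed.

(** * Uniqueness for linear differential equations *)

Section LinearODE.
Context {R : realType}.

Lemma is_derive_entry n (u : R -> 'cV[R]_n) t du i :
  is_derive t (1 : R) u du -> is_derive t (1 : R) (fun x => u x i 0) (du i 0).
Proof.
move=> [ud <-]; rewrite derive_mx// mxE; apply/DeriveDef => //.
exact: (derivable_mxP _ _ _).1.
Qed.

Lemma sqn_trmx_continuous n : continuous (fun v : 'cV[R]_n => sqn v^T).
Proof.
have -> : (fun v : 'cV[R]_n => sqn v^T) = (fun v => \sum_i v i 0 ^+ 2).
  by apply/funext => v; rewrite sqnE; apply: eq_bigr => i _; rewrite mxE.
move=> v; apply: (cvg_sum (F := nbhs v)) => i; under eq_cvg do rewrite expr2.
by rewrite expr2; apply: cvgM; exact: coord_continuous.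
Qed.

(** Gronwall: for K bounding the entries of A, the function exp(-2Kt)|u(t)|^2 has
    a nonpositive derivative off a finite set, so it stays below its initial
    value 0. *)
Lemma linear_ode_zero n (a b : R) (A : R -> 'M[R]_n) (u : R -> 'cV[R]_n) (s : seq R) :
  bounded_over `[a, b] A -> {within `[a, b], continuous u} -> u a = 0 ->
  (forall t, t \in `]a, b[ -> t \notin s -> is_derive t (1 : R) u (A t *m u t)) ->
  forall t, t \in `[a, b] -> u t = 0.
Proof.
move=> bA cu u0 du t0 t0ab.
have [K hK] : bounded_over `[a, b] (fun t => \sum_j \sum_i `|(A t)^T i j|).
  apply: bounded_over_sum => j; apply: bounded_over_sum => i.
  apply: bounded_over_norm.
  have -> : (fun t => (A t)^T i j) = (fun t => A t j i) by apply/funext => x; rewrite mxE.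
  exact: (bounded_over_mx _ _).1.
pose E t := sqn (u t)^T.
have EE : E = \sum_i (fun t => u t i 0) ^+ 2.
  apply/funext => t; rewrite /E sqnE fct_sumE; apply: eq_bigr => i _.
  by rewrite mxE.
pose F := (fun t => expR (- (2 * K) * t)) * E.
have [at0 t0b] : a <= t0 /\ t0 <= b by move: t0ab; rewrite in_itv/= => /andP.
have E0 t : 0 <= E t by exact: sqn_ge0.
suff : F t0 <= F a.
  rewrite /F /= /GRing.mul /= /E u0 trmx0.
  rewrite [X in _ <= _ * X](_ : _ = 0); last by apply/eqP; rewrite sqn_eq0.
  rewrite mulr0 pmulr_rle0 ?expR_gt0// => h.
  have : sqn (u t0)^T == 0 by rewrite eq_le h sqn_ge0.
  by rewrite sqn_eq0 => /eqP /(congr1 trmx); rewrite trmxK trmx0.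
apply: (@nonincreasing_off_finite _ s) => //.
  move=> t; apply: cvgM.
    apply: continuous_subspaceT => x; apply: continuous_comp; last exact: continuous_expR.
    by apply: cvgM; [exact: cvg_cst|exact: cvg_id].
  apply: (continuous_comp (f := u : subspace `[a, t0] -> _) (g := fun v => sqn v^T)).
    apply: (continuous_subspaceW _ cu).
    by apply: subset_itvl; rewrite bnd_simp.
  exact: sqn_trmx_continuous.
move=> t tab ts.
have tab' : t \in `]a, b[.
  by move: tab; rewrite !in_itv/= => /andP[-> /lt_le_trans]; exact.
have dut := du t tab' ts.
have dE : is_derive t (1 : R) E (2 * qform (A t)^T (u t)^T).
  rewrite EE.
  have -> : 2 * qform (A t)^T (u t)^T = \sum_i (2%:R * u t i 0 ^+ 1) *: (A t *m u t) i 0.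
    rewrite qformE mulr_sumr; apply: eq_bigr => i _.
    have S : \sum_j (u t)^T 0 j * (A t)^T j i = \sum_j A t i j * u t j 0.
      by apply: eq_bigr => j _; rewrite !mxE mulrC.
    by rewrite S [(_ *m _) i 0]mxE [(u t)^T 0 i]mxE expr1 /GRing.scale/=; ring.
  apply: is_derive_sum => i; apply: is_deriveX; exact: is_derive_entry.
have dF : is_derive t (1 : R) F
    (expR (- (2 * K) * t) * (2 * qform (A t)^T (u t)^T - 2 * K * E t)).
  have dexp : is_derive t (1 : R) (fun t => expR (- (2 * K) * t))
      (expR (- (2 * K) * t) * - (2 * K)).
    apply: (is_derive1_comp (f := expR) (g := (- (2 * K)) \*: id)).
    apply: is_derive_eq (is_deriveZ _ (is_derive_id t 1)) _.
    by rewrite /GRing.scale/= mulr1.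
  apply: is_derive_eq (is_deriveM dexp dE) _.
  by rewrite /GRing.scale/=; ring.
split; first exact: dF.(ex_derive).
rewrite (derive_val (is_derive := dF)).
rewrite pmulr_rle0 ?expR_gt0// subr_le0 -mulrA ler_pM2l//.
apply: le_trans (ler_norm _) _; apply: le_trans (qform_le _ _) _.
rewrite ler_wpM2r ?sqn_ge0//; apply: le_trans (ler_norm _) _; apply: hK.
by apply: subset_itv_oo_cc.
Qed.

End LinearODE.

(** * Linearity of the state and the matrix inequality along it *)

Section StateAndPenalty.
Context {R : realType} {nq ny nz nw : nat} {a b : R}.
Notation nzeta := (ny + (nz + nw))%N.
Notation nchi := (nq + (nzeta + nzeta))%N.
Implicit Types (x y : 'cV[R]_nchi) (s r t : R).

Lemma zeta_v_linear x y s r t :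
  zeta_v a b (s *: x + r *: y) t = s *: zeta_v a b x t + r *: zeta_v a b y t.
Proof.
by rewrite /zeta_v /foh /chi_zm /chi_zp; apply/colP => i; rewrite !mxE; ring.
Qed.

(** The defect u between both sides solves u' = A_q u with u(a) = 0, since the
    input terms are linear in the decision vector. *)
Lemma state_linear (Aq : R -> 'M[R]_nq) (Bqy : R -> 'M[R]_(nq, ny))
    (Bqz : R -> 'M[R]_(nq, nz)) (qv : 'cV[R]_nchi -> R -> 'cV[R]_nq) x y s r t :
  piecewise_continuous a b Aq ->
  (forall chi, is_state a b Aq Bqy Bqz chi (qv chi)) -> t \in `[a, b] ->
  qv (s *: x + r *: y) t = s *: qv x t + r *: qv y t.
Proof.
move=> /piecewise_continuous_bounded bA st tab; apply/eqP; rewrite -subr_eq0; apply/eqP.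
have [q0x cx [ex dx]] := st x; have [q0y cy [ey dy]] := st y.
have [q0 c [e d]] := st (s *: x + r *: y).
pose u := qv (s *: x + r *: y) - (s \*: qv x + r \*: qv y).
apply: (linear_ode_zero (u := u) (s := e ++ ex ++ ey) bA) tab.
- move=> v; apply: cvgB; first exact: c.
  by apply: cvgD; [apply: cvgZl_tmp; exact: cx|apply: cvgZl_tmp; exact: cy].
- change (qv (s *: x + r *: y) a - (s *: qv x a + r *: qv y a) = 0).
  by rewrite q0 q0x q0y /chi_q; apply/colP => i; rewrite !mxE; ring.
move=> v vab; rewrite !mem_cat !negb_or => /and3P[ve vx vy].
apply: is_derive_eq.
  apply: is_deriveB; first exact: d.
  by apply: is_deriveD; [apply: is_deriveZ; exact: dx|apply: is_deriveZ; exact: dy].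
change (u v) with (qv (s *: x + r *: y) v - (s *: qv x v + r *: qv y v)).
have yE (z w : 'cV[R]_nzeta) : y_of (s *: z + r *: w) = s *: y_of z + r *: y_of w.
  by apply/colP => i; rewrite !mxE.
have zE (z w : 'cV[R]_nzeta) : z_of (s *: z + r *: w) = s *: z_of z + r *: z_of w.
  by apply/colP => i; rewrite !mxE.
rewrite zeta_v_linear yE zE mulmxBr !mulmxDr -!scalemxAr.
move: (_ *m _) (_ *m _) (_ *m _) (_ *m _) (_ *m _) (_ *m _) (_ *m _).
by move=> m1 m2 m3 m4 m5 m6 m7; apply/colP => i; rewrite !mxE; ring.
Qed.

End StateAndPenalty.

Definition lmi {R : realType} {nq ny nz nw m : nat} (a b : R)
    (L : R -> 'cV[R]_nq -> 'cV[R]_(ny + (nz + nw)) -> 'M[R]_m)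
    (qv : 'cV[R]_(nq + ((ny + (nz + nw)) + (ny + (nz + nw)))) -> R -> 'cV[R]_nq)
    x t :=
  L t (qv x t) (zeta_v a b x t).

Section Penalty.
Context {R : realType} {nq ny nz nw m : nat} {a b : R}.
Notation nzeta := (ny + (nz + nw))%N.
Notation nchi := (nq + (nzeta + nzeta))%N.
Implicit Types (x y : 'cV[R]_nchi) (s r t : R).
Variable L : R -> 'cV[R]_nq -> 'cV[R]_nzeta -> 'M[R]_m.+1.
Hypothesis L_affine : affine_lmi a b L.

(** The constant term L0 is preserved because the weights add up to 1. *)
Lemma affine_lmi_comb s t q q' z z' : t \in `[a, b] ->
  L t (s *: q + (1 - s) *: q') (s *: z + (1 - s) *: z')
  = s *: L t q z + (1 - s) *: L t q' z'.
Proof.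
move=> tab; have [L0 [Lq [Lz [_ _ _ LE]]]] := L_affine; rewrite !LE//.
have comb (I : finType) (u v : I -> R) (M : I -> 'M[R]_m.+1) :
    \sum_i (s * u i + (1 - s) * v i) *: M i
    = s *: (\sum_i u i *: M i) + (1 - s) *: \sum_i v i *: M i.
  rewrite !scaler_sumr -big_split/=; apply: eq_bigr => i _.
  by rewrite !scalerA -scalerDl.
have colE n (u v : 'cV[R]_n) i : (s *: u + (1 - s) *: v) i 0 = s * u i 0 + (1 - s) * v i 0.
  by rewrite !mxE.
under eq_bigr do rewrite colE.
under [X in _ + X = _]eq_bigr do rewrite colE.
rewrite !comb; move: (\sum_i _) (\sum_i _) (\sum_i _) (\sum_i _) => m1 m2 m3 m4.
by apply/matrixP => i j; rewrite !mxE; ring.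
Qed.

Lemma zeta_v_entry_continuous x k : continuous (fun t => zeta_v a b x t k 0).
Proof.
have -> : (fun t => zeta_v a b x t k 0) = (fun t =>
    (b - t) * ((b - a)^-1 * chi_zm x k 0) + (t - a) * ((b - a)^-1 * chi_zp x k 0)).
  by apply/funext => t; rewrite !mxE !mulrA.
move=> t; apply: cvgD; apply: cvgM; try exact: cvg_cst; apply: cvgB;
  by [exact: cvg_cst|exact: cvg_id].
Qed.

Hypothesis ab : a < b.
Variables (qv : 'cV[R]_nchi -> R -> 'cV[R]_nq) (x : 'cV[R]_nchi).
Hypothesis qv_cont : {within `[a, b], continuous (qv x)}.

Lemma lmi_entry_bounded i j : bounded_over `[a, b] (fun t => lmi a b L qv x t i j).
Proof.
have [L0 [Lq [Lz [[/bounded_overP b0 _] bq bz LE]]]] := L_affine.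
have ent k l (M : R -> 'M[R]_(k, l)) : bounded_over `[a, b] M ->
    forall i j, bounded_over `[a, b] (fun t => M t i j).
  by move=> bM i' j'; exact: ((bounded_over_mx _ _).1 bM).
have [K hK] : bounded_over `[a, b] (fun t => (L0 t i j + \sum_k qv x t k 0 * Lq k t i j)
    + \sum_k zeta_v a b x t k 0 * Lz k t i j).
  apply: bounded_overD; first apply: bounded_overD.
  - exact: ent.
  - apply: bounded_over_sum => k; apply: bounded_overM.
      by apply: ent; exact: continuous_itv_bounded.
    by apply: ent; apply/bounded_overP; exact: (bq k).1.
  - apply: bounded_over_sum => k; apply: bounded_overM.
      by apply/continuous_itv_bounded/continuous_subspaceT/zeta_v_entry_continuous.
    by apply: ent; apply/bounded_overP; exact: (bz k).1.
exists K => t tab; apply: le_trans (hK t tab); rewrite /lmi LE// !mxE !summxE.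
under eq_bigr do rewrite mxE; under [X in `|_ + X|]eq_bigr do rewrite mxE.
by [].
Qed.

(** The exceptional set collects those of all the coefficients.  The affine formula
    holds only on the interval, hence the detour through a neighbourhood of the
    interior point t. *)
Lemma lmi_entry_continuous : exists e : seq R, forall t, t \in `]a, b[ -> t \notin e ->
  forall i j, {for t, continuous (fun t => lmi a b L qv x t i j)}.
Proof.
have [L0 [Lq [Lz [[_ [[e0 c0] _ _]] pq pz LE]]]] := L_affine.
have cq k : exists e : seq R, forall t, t \in `]a, b[ -> t \notin e ->
   {for t, continuous (Lq k)} by have [_ []] := pq k.
have cz k : exists e : seq R, forall t, t \in `]a, b[ -> t \notin e ->
   {for t, continuous (Lz k)} by have [_ []] := pz k.
pose eq k := sval (cid (cq k)); pose ez k := sval (cid (cz k)).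
exists (e0 ++ flatten [seq eq k | k <- enum 'I_nq] ++ flatten [seq ez k | k <- enum 'I_nzeta]).
move=> t tab; rewrite !mem_cat !negb_or => /and3P[t0 tq tz] i j.
have cq_t k : {for t, continuous (Lq k)}.
  apply: (svalP (cid (cq k))) => //; apply: contra tq => tk.
  by apply/flattenP; exists (eq k) => //; apply: map_f; rewrite mem_enum.
have cz_t k : {for t, continuous (Lz k)}.
  apply: (svalP (cid (cz k))) => //; apply: contra tz => tk.
  by apply/flattenP; exists (ez k) => //; apply: map_f; rewrite mem_enum.
have cqv : {for t, continuous (qv x)}.
  have [+ _ _] := (continuous_within_itvP _ ab).1 qv_cont; exact.
have entry k l (M : R -> 'M[R]_(k, l)) i' j' : {for t, continuous M} ->
    {for t, continuous (fun t => M t i' j')}.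
  move=> cM; apply: (continuous_comp (g := fun A : 'M[R]_(k, l) => A i' j') cM).
  exact: coord_continuous.
pose G t := (L0 t i j + \sum_k qv x t k 0 * Lq k t i j)
    + \sum_k zeta_v a b x t k 0 * Lz k t i j.
have GE t' : t' \in `[a, b] -> lmi a b L qv x t' i j = G t'.
  move=> t'ab; rewrite /lmi LE// !mxE !summxE.
  by under eq_bigr do rewrite mxE; under [X in _ + X = _]eq_bigr do rewrite mxE.
rewrite /prop_for /continuous_at GE; last exact: subset_itv_oo_cc tab.
have cG : G t' @[t' --> t] --> G t.
  apply: cvgD; first apply: cvgD.
  - exact: (entry _ _ _ _ _ (c0 t tab t0)).
  - apply: cvg_sum => k; apply: cvgM; exact: entry.
  - apply: cvg_sum => k; apply: cvgM; last exact: entry.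
    exact: zeta_v_entry_continuous.
apply: cvg_trans cG; apply: near_eq_cvg.
have : \forall t' \near t, t' \in `]a, b[ by exact: near_in_itvoo.
by apply: filterS => t' t'ab; rewrite GE//; exact: subset_itv_oo_cc t'ab.
Qed.

End Penalty.

(** * The penalty: convexity, boundedness, measurability *)

Section PenaltyRegularity.
Context {R : realType} {nq ny nz nw m : nat} {a b p : R}.
Notation nzeta := (ny + (nz + nw))%N.
Notation nchi := (nq + (nzeta + nzeta))%N.

(** The hypothesis is an inequality because the largest eigenvalue at a convex
    combination is only bounded by the combination; monotonicity of the hinge
    power absorbs the difference. *)
Lemma hinge_powR_convex (s u v w : R) : 1 <= p -> 0 <= s <= 1 ->
  w <= s * u + (1 - s) * v ->
  Num.max 0 w `^ p <= s * Num.max 0 u `^ p + (1 - s) * Num.max 0 v `^ p.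
Proof.
move=> p1 /andP[s0 s1] wuv; have s1' : 0 <= 1 - s by rewrite subr_ge0.
have pos z : 0 <= Num.max 0 z :> R by rewrite le_max lexx.
have cpos : 0 <= s * Num.max 0 u + (1 - s) * Num.max 0 v.
  by rewrite addr_ge0// mulr_ge0.
apply: (@le_trans _ _ ((s * Num.max 0 u + (1 - s) * Num.max 0 v) `^ p)).
  apply: (ge0_ler_powR (le_trans ler01 p1)); rewrite ?nnegrE//.
  rewrite ge_max cpos/=; apply: le_trans wuv _.
  by apply: lerD; apply: ler_wpM2l => //; rewrite le_max lexx orbT.
have := convex_powR p1 (Itv01 s0 s1) (x := Num.max 0 u) (y := Num.max 0 v).
rewrite !inE /= !in_itv/= !pos => /(_ isT isT).
by rewrite !convRE.
Qed.

Variable L : R -> 'cV[R]_nq -> 'cV[R]_nzeta -> 'M[R]_m.+1.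
Hypotheses (ab : a < b) (p1 : 1 <= p).
Hypothesis L_sym : forall t q zeta, t \in `[a, b] -> (L t q zeta)^T = L t q zeta.
Hypothesis L_affine : affine_lmi a b L.

Lemma penalty_convex (Aq : R -> 'M[R]_nq) (Bqy : R -> 'M[R]_(nq, ny))
    (Bqz : R -> 'M[R]_(nq, nz)) (qv : 'cV[R]_nchi -> R -> 'cV[R]_nq) t :
  piecewise_continuous a b Aq ->
  (forall chi, is_state a b Aq Bqy Bqz chi (qv chi)) -> t \in `[a, b] ->
  convexf (penalty a b p qv L t).
Proof.
move=> pcA st tab s x y s01; apply: hinge_powR_convex => //.
rewrite (state_linear _ _ _ _ pcA st tab) zeta_v_linear (affine_lmi_comb L_affine)//.
by apply: lambda_max_convex => //; exact: L_sym.
Qed.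

Variables (qv : 'cV[R]_nchi -> R -> 'cV[R]_nq) (x : 'cV[R]_nchi).
Hypothesis qv_cont : {within `[a, b], continuous (qv x)}.

Lemma penalty_bounded : bounded_over `[a, b] (fun t => penalty a b p qv L t x).
Proof.
have [K hK] : bounded_over `[a, b] (fun t => \sum_j \sum_i `|lmi a b L qv x t i j|).
  apply: bounded_over_sum => j; apply: bounded_over_sum => i.
  by apply: bounded_over_norm; exact: lmi_entry_bounded.
exists (Num.max 0 K `^ p) => t tab; rewrite ger0_norm ?powR_ge0//.
apply: (ge0_ler_powR (le_trans ler01 p1)); [by rewrite nnegrE le_max lexx..|].
rewrite ge_max !le_max lexx/=; apply/orP; right.
apply: (le_trans _ (le_trans (ler_norm _) (hK t tab))).
have [[w w1 <-] _] := lambda_max_qform (L_sym (qv x t) (zeta_v a b x t) tab).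
apply: le_trans (ler_norm _) _; apply: le_trans (qform_le _ _) _.
by rewrite w1 mulr1.
Qed.

(** Off the exceptional points the largest eigenvalue is continuous in t by the
    Lipschitz bound. *)
Lemma penalty_measurable : measurable_fun `[a, b] (fun t => penalty a b p qv L t x).
Proof.
apply: (@measurableT_comp _ _ _ _ _ _ (fun u : R => u `^ p)).
  exact: measurable_powR.
apply: measurable_maxr; first exact: measurable_cst.
have [e he] := lmi_entry_continuous L_affine ab qv_cont.
apply: (@measurable_continuous_off_finite _ _ _ e) => t tab te.
have tin : t \in `[a, b] by exact: subset_itv_oo_cc tab.
apply/cvgrPdist_le => eps eps0.
have : \sum_j \sum_i `|lmi a b L qv x t i j - lmi a b L qv x t' i j| @[t' --> t] --> (0 : R).
  rewrite [X in _ --> X](_ : _ = \sum_(j < m.+1) \sum_(i < m.+1) 0); last first.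
    by rewrite big1// => j _; rewrite big1.
  apply: cvg_sum => j; apply: cvg_sum => i.
  have := cvg_norm (cvgB (cvg_cst (lmi a b L qv x t i j)) (he t tab te i j)).
  by rewrite subrr normr0; exact.
move=> /cvgrPdist_le/(_ _ eps0) h.
near=> t'.
have t'in : t' \in `[a, b].
  by apply: subset_itv_oo_cc; near: t'; exact: near_in_itvoo.
apply: le_trans (lambda_max_lipschitz (L_sym _ _ tin) (L_sym _ _ t'in)) _.
have : `|0 - (\sum_j \sum_i `|lmi a b L qv x t i j - lmi a b L qv x t' i j|)| <= eps.
  by near: t'.
by rewrite sub0r normrN => /(le_trans (ler_norm _)).
Unshelve. all: by end_near. Qed.

End PenaltyRegularity.

Lemma dotv_delta {R : realType} n (g : 'cV[R]_n) i : dotv g (delta_mx i 0) = g i 0.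
Proof.
rewrite /dotv (bigD1 i)//= big1 => [|j /negbTE ji]; first by rewrite !mxE !eqxx mulr1 addr0.
by rewrite mxE ji mulr0.
Qed.

(** The subgradient inequality at x + e_i bounds the i-th coordinate from above,
    at x - e_i from below. *)
Lemma subdifferential_entry_bound {R : realType} n (f : 'cV[R]_n -> R) x g i :
  subdifferential f x g ->
  `|g i 0| <= `|f x| + `|f (x + delta_mx i 0)| + `|f (x - delta_mx i 0)|.
Proof.
move=> sub; have := sub (x + delta_mx i 0); have := sub (x - delta_mx i 0).
rewrite ![_ + _ - x]addrAC subrr !add0r dotv_delta.
have -> : dotv g (- delta_mx i 0) = - g i 0.
  rewrite -(dotv_delta g i) /dotv -sumrN; apply: eq_bigr => j _.
  by rewrite [in LHS]mxE mulrN.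
have := ler_norm (f (x + delta_mx i 0)); have := ler_norm (f (x - delta_mx i 0)).
have := ler_norm (- f x); rewrite normrN.
have := normr_ge0 (f (x + delta_mx i 0)); have := normr_ge0 (f (x - delta_mx i 0)).
by rewrite ler_norml => *; apply/andP; split; lra.
Qed.

(** Borel sets are Lebesgue measurable. *)
Lemma measurable_fun_lebesgueType {R : realType} (D : set R) (f : R -> R) :
  measurable D -> measurable_fun D f ->
  measurable_fun (D : set (lebesgueType R)) (f : lebesgueType R -> R).
Proof.
by move=> mD mf _ Y mY; apply: sub_caratheodory; exact: mf.
Qed.

(** * Measurable bounded selection *)

Theorem theorem27 (R : realType) (nq ny nz nw m : nat) (tk tk1 : R)
  (tk_lt : tk < tk1)
  (Aq : R -> 'M[R]_nq) (Bqy : R -> 'M[R]_(nq, ny)) (Bqz : R -> 'M[R]_(nq, nz))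
  (Aq_pc : piecewise_continuous tk tk1 Aq)
  (Bqy_pc : piecewise_continuous tk tk1 Bqy)
  (Bqz_pc : piecewise_continuous tk tk1 Bqz)
  (qv : 'cV[R]_(nq + ((ny + (nz + nw)) + (ny + (nz + nw)))) -> R -> 'cV[R]_nq)
  (qv_state : forall chi, is_state tk tk1 Aq Bqy Bqz chi (qv chi))
  (L : R -> 'cV[R]_nq -> 'cV[R]_(ny + (nz + nw)) -> 'M[R]_m.+1)
  (L_sym : forall t q zeta, t \in `[tk, tk1] -> (L t q zeta)^T = L t q zeta)
  (L_affine : affine_lmi tk tk1 L)
  (p : R) (p_ge1 : 1 <= p)
  (chi : 'cV[R]_(nq + ((ny + (nz + nw)) + (ny + (nz + nw))))) :
  exists g : lebesgueType R -> 'cV[R]_(nq + ((ny + (nz + nw)) + (ny + (nz + nw)))),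
    [/\ forall i, measurable_fun (`[tk, tk1] : set (lebesgueType R))
                                 (fun t => g t i 0),
        {ae completed_lebesgue_measure, forall t : R, t \in `[tk, tk1] ->
          subdifferential (penalty tk tk1 p qv L t) chi (g t)},
        [bounded g t | t in `[tk, tk1]]
      & forall i, completed_lebesgue_measure.-integrable
                    (`[tk, tk1] : set (lebesgueType R))
                    (fun t => (g t i 0)%:E)].
Proof.
have qc y : {within `[tk, tk1], continuous (qv y)} by have [] := qv_state y.
have [g [mg sg]] := measurable_subgradient (D := `[tk, tk1]%classic)
  (f := penalty tk tk1 p qv L) chi (measurable_itv _)
  (fun t tab => penalty_convex p_ge1 L_sym L_affine Aq_pc qv_state tab)
  (fun y => penalty_measurable tk_lt L_sym L_affine (qc y)).
have bg i : bounded_over `[tk, tk1] (fun t => g t i 0).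
  have bp y := penalty_bounded p_ge1 L_sym L_affine (qc y).
  have [K hK] := bounded_overD (bounded_overD (bounded_over_norm (bp chi))
    (bounded_over_norm (bp (chi + delta_mx i 0))))
    (bounded_over_norm (bp (chi - delta_mx i 0))).
  exists K => t tab; apply: le_trans (subdifferential_entry_bound i (sg t tab)) _.
  exact: le_trans (ler_norm _) (hK t tab).
have mgL i := measurable_fun_lebesgueType (measurable_itv _) (mg i).
exists g; split => //.
- exact: aeW.
- apply/bounded_overP/bounded_over_mx => i j; rewrite ord1; exact: bg.
- move=> i; apply: measurable_bounded_integrable => //.
  + by apply: sub_caratheodory; exact: measurable_itv.
  + have := @lebesgue_measure_itv R `[tk, tk1]; rewrite /= lte_fin tk_lt => mu_itv.
    by change (lebesgue_measure `[tk, tk1]%classic < +oo)%E; rewrite mu_itv ltry.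
  + exact/bounded_overP.
Qed.
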